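(* If $u\colon R\to U$ is an epimorphism of commutative rings such that $\operatorname{Tor}^R_1(U,U)=0$ and the projective dimension of the $R$-module $U$ does not exceed $1$, then $U$ is a flat $R$-module.
   Context: A homomorphism $u\colon R\to U$ of commutative (unital) rings is a ring epimorphism iff the multiplication map $U\otimes_R U\to U$ is an isomorphism; it is not assumed injective. *)

(* Defs.v *)
From HB Require Import structures.
From mathcomp Require Import all_boot all_algebra.
From mathcomp Require Import finmap boolp.
From mathcomp.multinomials Require Import monalg.

Set Implicit Arguments.
Unset Strict Implicit.
Unset Printing Implicit Defensive.

Import GRing.Theory.
Local Open Scope fset_scope.
Local Open Scope ring_scope.

(* Rings are comPzRingType rather than comNzRingType: the zero ring is allowed. *)

Section LinearMaps.
Variable R : comPzRingType.

Definition surjective (A B : Type) (f : A -> B) := forall b, exists a, f a = b.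

Definition exact_at (A B C : lmodType R) (f : A -> B) (g : B -> C) :=
  forall y, g y = 0 <-> exists x, f x = y.

Definition zero_module (M : lmodType R) := forall x : M, x = 0.

Definition is_bilinear (M N P : lmodType R) (f : M -> N -> P) :=
  (forall y, linear (f^~ y)) /\ (forall x, linear (f x)).

End LinearMaps.

(* Quotient.quot is only a zmodType; scaling is added on the alias quotmod. *)
Section QuotientModule.
Variables (R : comPzRingType) (M : lmodType R).
Variables (S : {pred M}) (SP : submod_closed S).

Definition submod_pred of submod_closed S : {pred M} := S.

HB.instance Definition _ :=
  GRing.isSubmodClosed.Build R M (submod_pred SP) SP.

Definition quotmod := Quotient.quot (submod_pred SP).

HB.instance Definition _ := GRing.Zmodule.on quotmod.
HB.instance Definition _ := Quotient.on quotmod.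

Definition qproj (x : M) : quotmod := \pi_quotmod%qT x.

Lemma qprojP x y : qproj x = qproj y <-> x - y \in S.
Proof.
by rewrite -[S]/(submod_pred SP : {pred M}) Quotient.idealrBE; split=> /eqP.
Qed.

Lemma qproj_surj : surjective qproj.
Proof. by move=> q; exists (repr q); rewrite /qproj reprK. Qed.

Lemma qproj_reprP x : repr (qproj x) - x \in S.
Proof. by apply/qprojP; rewrite /qproj reprK. Qed.

Lemma qprojD x y : qproj (x + y) = qproj x + qproj y.
Proof. by rewrite /qproj !piE. Qed.

Definition qscale (a : R) (q : quotmod) : quotmod := qproj (a *: repr q).

Lemma qscaleE a x : qscale a (qproj x) = qproj (a *: x).
Proof.
apply/qprojP; rewrite -scalerBr.
exact: (GRing.subsemimodClosedP (submod_pred SP)).2 (qproj_reprP x).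
Qed.

Fact qscaleA a b q : qscale a (qscale b q) = qscale (a * b) q.
Proof. by have [x <-] := qproj_surj q; rewrite !qscaleE scalerA. Qed.

Fact qscale1 : left_id 1 qscale.
Proof. by move=> q; have [x <-] := qproj_surj q; rewrite qscaleE scale1r. Qed.

Fact qscaleDr : right_distributive qscale +%R.
Proof.
move=> a p q; have [x <-] := qproj_surj p; have [y <-] := qproj_surj q.
by rewrite -qprojD !qscaleE -qprojD scalerDr.
Qed.

Fact qscaleDl q : {morph qscale^~ q : a b / a + b}.
Proof.
move=> a b; have [x <-] := qproj_surj q.
by rewrite !qscaleE -qprojD scalerDl.
Qed.

HB.instance Definition _ := GRing.Zmodule_isLmodule.Build R quotmod
  qscaleA qscale1 qscaleDr qscaleDl.

Fact qproj_linear : linear qproj.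
Proof. by move=> a x y; rewrite qprojD -qscaleE. Qed.

HB.instance Definition _ :=
  GRing.isLinear.Build R M quotmod *:%R qproj qproj_linear.

End QuotientModule.

(* {malg R[K]} (finitely supported functions K -> R) is only an lmodType over *)
(* nontrivial rings, hence the alias.                                         *)
Section FreeModule.
Variables (R : comPzRingType) (K : choiceType).

Definition freemod := {malg R[K]}.

HB.instance Definition _ := GRing.Zmodule.on freemod.

Definition fscale (a : R) (g : freemod) : freemod :=
  [malg k in msupp g => a * g@_k].

Lemma fscaleE a g k : (fscale a g)@_k = a * g@_k.
Proof. by rewrite mcoeffE; case: msuppP; rewrite ?mulr0. Qed.

Fact fscaleA a b g : fscale a (fscale b g) = fscale (a * b) g.
Proof. by apply/malgP=> k; rewrite !fscaleE mulrA. Qed.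

Fact fscale1 : left_id 1 fscale.
Proof. by move=> g; apply/malgP=> k; rewrite fscaleE mul1r. Qed.

Fact fscaleDr : right_distributive fscale +%R.
Proof. by move=> a g h; apply/malgP=> k; rewrite mcoeffD !fscaleE mcoeffD mulrDr. Qed.

Fact fscaleDl g : {morph fscale^~ g : a b / a + b}.
Proof. by move=> a b; apply/malgP=> k; rewrite mcoeffD !fscaleE mulrDl. Qed.

HB.instance Definition _ := GRing.Zmodule_isLmodule.Build R freemod
  fscaleA fscale1 fscaleDr fscaleDl.

Definition fgen (k : K) : freemod := mkmalgU k 1.

Section Lift.
Variables (M : lmodType R) (phi : K -> M).

Definition freelift (g : freemod) : M := \sum_(k <- msupp g) g@_k *: phi k.

Lemma freeliftEw (g : freemod) (D : {fset K}) : msupp g `<=` D ->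
  freelift g = \sum_(k <- D) g@_k *: phi k.
Proof.
move=> sgD; rewrite /freelift; apply: big_fset_incl => // k _ kg.
by rewrite mcoeff_outdom ?scale0r.
Qed.

Fact freelift_linear : linear freelift.
Proof.
move=> a g h; set D := msupp g `|` msupp h `|` msupp (a *: g + h).
have gD : msupp g `<=` D.
  by apply/fsubsetP=> k kg; rewrite /D !in_fsetU kg.
have hD : msupp h `<=` D.
  by apply/fsubsetP=> k kh; rewrite /D !in_fsetU kh orbT.
have aD : msupp (a *: g + h) `<=` D.
  by apply/fsubsetP=> k kh; rewrite /D in_fsetU kh orbT.
rewrite (freeliftEw gD) (freeliftEw hD) (freeliftEw aD).
rewrite scaler_sumr -big_split; apply: eq_bigr => k _ /=.
by rewrite mcoeffD fscaleE scalerDl scalerA.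
Qed.

HB.instance Definition _ :=
  GRing.isLinear.Build R freemod M *:%R freelift freelift_linear.

Lemma freelift_gen k : freelift (fgen k) = phi k.
Proof.
by rewrite (freeliftEw (D := [fset k])) ?msuppU_le // big_seq_fset1 mcoeffUU scale1r.
Qed.

End Lift.

Lemma freemodE (g : freemod) : g = \sum_(k <- msupp g) g@_k *: fgen k.
Proof.
rewrite [LHS](@monalgE K R g); apply: eq_bigr => k _; apply/malgP => j.
by rewrite fscaleE !mcoeffU mulrnAr mulr1.
Qed.

Lemma freemod_ext (M : lmodType R) (f g : {linear freemod -> M}) :
  (forall k, f (fgen k) = g (fgen k)) -> f =1 g.
Proof.
move=> fg x; rewrite (freemodE x) !raddf_sum; apply: eq_bigr => k _ /=.
by rewrite !linearZ /= fg.
Qed.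

End FreeModule.

Section TensorProduct.
Variables (R : comPzRingType) (M N : lmodType R).

Local Notation F := (freemod R (M * N)%type).

Variant tensor_relation : F -> Prop :=
| TensorRelL a x x' y : tensor_relation
    (fgen R (a *: x + x', y) - (a *: fgen R (x, y) + fgen R (x', y)))
| TensorRelR a x y y' : tensor_relation
    (fgen R (x, a *: y + y') - (a *: fgen R (x, y) + fgen R (x, y'))).

(* the submodule generated by the relations: the intersection of all          *)
(* submodules containing them                                                 *)
Definition tensor_rels : {pred F} := fun z =>
  `[< forall S : {pred F}, submod_closed S ->
        (forall r, tensor_relation r -> r \in S) -> z \in S >].

Fact tensor_rels_submod : submod_closed tensor_rels.
Proof.
split=> [|a z t /asboolP zS /asboolP tS].
  by apply/asboolP=> S [].
by apply/asboolP=> S SP rS; apply: SP.2; [apply: zS|apply: tS].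
Qed.

Definition tensor := quotmod tensor_rels_submod.

HB.instance Definition _ := GRing.Lmodule.on tensor.

Definition tens (x : M) (y : N) : tensor := qproj tensor_rels_submod (fgen R (x, y)).

Lemma tens_bilinear : is_bilinear tens.
Proof.
split=> [y a x x'|x a y y']; rewrite /tens -[RHS]qproj_linear; apply/qprojP;
  apply/asboolP=> S _; apply.
- exact: TensorRelL.
- exact: TensorRelR.
Qed.

Section Lift.
Variables (P : lmodType R) (f : M -> N -> P).

(* bf is not used in the value; it is what makes tensor_lift linear *)
Definition tensor_lift (bf : is_bilinear f) (t : tensor) : P :=
  freelift (fun p => f p.1 p.2) (repr t).

Hypothesis bf : is_bilinear f.

Let ker_lift : {pred F} :=
  fun z => freelift (fun p => f p.1 p.2) z == 0.

Let ker_lift_submod : submod_closed ker_lift.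
Proof.
split=> [|a z t /eqP z0 /eqP t0]; first by rewrite unfold_in linear0.
by rewrite unfold_in linearP /= z0 t0 scaler0 addr0.
Qed.

Let rels_lift0 z : z \in tensor_rels -> freelift (fun p => f p.1 p.2) z = 0.
Proof.
move=> /asboolP /(_ ker_lift ker_lift_submod) zS; apply/eqP/zS => r [a x x' y|a x y y'];
  rewrite unfold_in linearB linearP /= !freelift_gen /=.
- by rewrite bf.1 subrr.
- by rewrite bf.2 subrr.
Qed.

Lemma tensor_lift_qproj z :
  tensor_lift bf (qproj tensor_rels_submod z) = freelift (fun p => f p.1 p.2) z.
Proof.
apply/eqP; rewrite -subr_eq0 -linearB; apply/eqP/rels_lift0.
exact: qproj_reprP.
Qed.

Fact tensor_lift_linear : linear (tensor_lift bf).
Proof.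
move=> a s t; have [x <-] := qproj_surj s; have [y <-] := qproj_surj t.
by rewrite -linearP !tensor_lift_qproj linearP.
Qed.

HB.instance Definition _ :=
  GRing.isLinear.Build R tensor P *:%R (tensor_lift bf) tensor_lift_linear.

Lemma tensor_lift_tens x y : tensor_lift bf (tens x y) = f x y.
Proof. by rewrite tensor_lift_qproj freelift_gen. Qed.

End Lift.

Lemma tensor_ext (P : lmodType R) (f g : {linear tensor -> P}) :
  (forall x y, f (tens x y) = g (tens x y)) -> f =1 g.
Proof.
move=> fg t; have [z <-] := qproj_surj t.
apply: (@freemod_ext _ _ _ (f \o qproj tensor_rels_submod) (g \o qproj tensor_rels_submod)).
by case=> x y; apply: fg.
Qed.

End TensorProduct.

Section TensorMap.
Variables (R : comPzRingType) (M M' N N' : lmodType R).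
Variables (f : {linear M -> M'}) (g : {linear N -> N'}).

Fact tensor_map_bilinear : is_bilinear (fun x y => tens (f x) (g y)).
Proof.
split=> [y a x x'|x a y y']; rewrite linearP.
- exact: (tens_bilinear M' N').1.
- exact: (tens_bilinear M' N').2.
Qed.

Definition tensor_map : {linear tensor M N -> tensor M' N'} :=
  tensor_lift tensor_map_bilinear.

Lemma tensor_map_tens x y : tensor_map (tens x y) = tens (f x) (g y).
Proof. exact: tensor_lift_tens. Qed.

End TensorMap.

Section Homology.
Variables (R : comPzRingType) (A B C : lmodType R).
Variables (f : {linear A -> B}) (g : {linear B -> C}).

Definition linker : {pred B} := fun y => g y == 0.

Fact linker_submod : submod_closed linker.
Proof.
split=> [|a x y /eqP x0 /eqP y0]; first by rewrite unfold_in linear0.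
by rewrite unfold_in linearP /= x0 y0 scaler0 addr0.
Qed.

HB.instance Definition _ :=
  GRing.isSubmodClosed.Build R B linker linker_submod.

Record kermod := KerMod { kermod_val : B; kermod_valP : kermod_val \in linker }.

HB.instance Definition _ := [isSub for kermod_val].
HB.instance Definition _ := [Choice of kermod by <:].
HB.instance Definition _ := [SubChoice_isSubLmodule of kermod by <:].

Definition boundaries : {pred kermod} :=
  fun y => `[< exists x, f x = val y >].

Fact boundaries_submod : submod_closed boundaries.
Proof.
split=> [|a y z /asboolP[x fx] /asboolP[x' fx']]; apply/asboolP.
  by exists 0; rewrite linear0 (linear0 (val : {linear kermod -> B})).
by exists (a *: x + x'); rewrite linearP fx fx' (linearP (val : {linear kermod -> B})).
Qed.

(* Ker g / (Im f :&: Ker g); for g \o f = 0 this is the homology Ker g / Im f *)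
Definition homology : lmodType R := quotmod boundaries_submod.

End Homology.

Section Resolutions.
Variable R : comPzRingType.

Definition projective (P : lmodType R) :=
  forall (A B : lmodType R) (g : {linear A -> B}) (f : {linear P -> B}),
  surjective g -> exists h : {linear P -> A}, forall x, g (h x) = f x.

Record projres (M : lmodType R) := ProjRes {
  res : nat -> lmodType R;
  res_d : forall n, {linear res n.+1 -> res n};
  res_eps : {linear res 0 -> M};
  res_proj : forall n, projective (res n);
  res_surj : surjective res_eps;
  res_exact0 : exact_at (res_d 0) res_eps;
  res_exact : forall n, exact_at (res_d n.+1) (res_d n)
}.

Definition proj_dim_le (n : nat) (M : lmodType R) :=
  exists P : projres M, forall k, (n < k)%N -> zero_module (res P k).

Lemma freemod_projective (K : choiceType) : projective (freemod R K).
Proof.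
move=> A B g f gs; have /choice[h hE] k := gs (f (fgen R k)).
exists (freelift h : {linear _ -> _}).
apply: (@freemod_ext _ _ _ (g \o freelift h : {linear _ -> _}) f) => k /=.
by rewrite freelift_gen.
Qed.

(* The standard free resolution ... -> F_1 -> F_0 -> M: F_0 is free on the    *)
(* set M, and F_(n+1) is free on the set Ker (F_n -> F_(n-1)).                *)
Record linmap := LinMap {
  lsrc : lmodType R; ltgt : lmodType R; larr : {linear lsrc -> ltgt} }.

Definition free_step (h : linmap) : linmap :=
  LinMap (freelift (@kermod_val _ _ _ (larr h)) : {linear _ -> _}).

Fixpoint free_steps (M : lmodType R) (n : nat) : linmap :=
  if n is n'.+1 then free_step (free_steps M n')
  else LinMap (freelift (id : M -> M) : {linear _ -> _}).

Lemma free_step_exact h : exact_at (larr (free_step h)) (larr h).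
Proof.
move=> y; split=> [hy|[x <-]] /=.
  have yP : y \in linker (larr h) by apply/eqP.
  by exists (fgen R (KerMod yP)); rewrite freelift_gen.
rewrite [freelift _ x]/freelift linear_sum big1 // => k _.
by rewrite linearZ /= (eqP (kermod_valP k)) scaler0.
Qed.

Definition free_res (M : lmodType R) : projres M.
Proof.
refine (@ProjRes M (fun n => lsrc (free_steps M n))
  (fun n => larr (free_steps M n.+1)) (larr (free_steps M 0)) _ _ _ _).
- by case=> [|n]; apply: freemod_projective.
- by move=> x; exists (fgen R x); rewrite /= freelift_gen.
- exact: free_step_exact.
- by move=> n; apply: free_step_exact.
Defined.

Section Tor.
Variables (n : nat) (M N : lmodType R).

Definition tensor_res (P : projres M) (k : nat) : lmodType R :=
  tensor (res P k) N.

Definition tensor_res_d (P : projres M) (k : nat) :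
    {linear tensor_res P k.+1 -> tensor_res P k} :=
  tensor_map (res_d P k) (idfun : {linear N -> N}).

(* the differential leaving degree k; it is zero for k = 0, where k.-1 = 0 is *)
(* a dummy target                                                             *)
Definition tensor_res_out (P : projres M) (k : nat) :
    {linear tensor_res P k -> tensor_res P k.-1} :=
  if k is k'.+1 then tensor_res_d P k' else \0.

Definition Tor : lmodType R :=
  homology (tensor_res_d (free_res M) n) (tensor_res_out (free_res M) n).

End Tor.

Definition flat (M : lmodType R) :=
  forall (A B C : lmodType R) (f : {linear A -> B}) (g : {linear B -> C}),
  exact_at f g ->
  exact_at (tensor_map f (idfun : {linear M -> M}))
           (tensor_map g (idfun : {linear M -> M})).

End Resolutions.

(* u is a phantom parameter: it selects the R-module structure *)
Definition restr (R U : comPzRingType) (u : {rmorphism R -> U}) : Type := U.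

Section Restriction.
Variables (R U : comPzRingType) (u : {rmorphism R -> U}).

Local Notation restr := (restr u).

HB.instance Definition _ := GRing.Zmodule.on restr.

Definition rscale (a : R) (x : restr) : restr := u a * (x : U).

Fact rscaleA a b x : rscale a (rscale b x) = rscale (a * b) x.
Proof. by rewrite /rscale rmorphM mulrA. Qed.

Fact rscale1 : left_id 1 rscale.
Proof. by move=> x; rewrite /rscale rmorph1 mul1r. Qed.

Fact rscaleDr : right_distributive rscale +%R.
Proof. by move=> a x y; rewrite /rscale mulrDr. Qed.

Fact rscaleDl x : {morph rscale^~ x : a b / a + b}.
Proof. by move=> a b; rewrite /rscale rmorphD mulrDl. Qed.

HB.instance Definition _ := GRing.Zmodule_isLmodule.Build R restr
  rscaleA rscale1 rscaleDr rscaleDl.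

Definition restr_mul (x y : restr) : restr := (x : U) * (y : U).

Fact restr_mul_bilinear : is_bilinear restr_mul.
Proof.
split=> [y a x x'|x a y y']; rewrite /restr_mul.
- by rewrite mulrDl -mulrA.
- by rewrite mulrDr mulrCA.
Qed.

(* the multiplication map U \otimes_R U -> U *)
Definition mul_map : {linear tensor restr restr -> restr} :=
  tensor_lift restr_mul_bilinear.

Lemma mul_map_tens x y : mul_map (tens x y) = restr_mul x y.
Proof. exact: tensor_lift_tens. Qed.

Definition ring_epi := bijective mul_map.

End Restriction.

(* Main.v *)
From HB Require Import structures.
Require Import Defs.
From mathcomp Require Import all_boot all_algebra.
From mathcomp Require Import finmap boolp classical_sets.
From mathcomp.multinomials Require Import monalg.

(** Take a resolution 0 -> P1 -d-> P0 -eps-> U -> 0 by projectives. The module U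
    is flat as soon as d is a pure monomorphism, and since P1 and P0 are
    projective, purity of d can be tested at residue fields: it is enough that
    d (x) R/m be injective for every maximal ideal m, that is, that d x in m P0
    implies x in m P1.

    Injectivity at m is where the epimorphism is used. The vanishing of
    Tor_1(U, U) says that d (x) U is injective, so that P1 (x) U -> P0 (x) U is
    the kernel of P0 (x) U -> U (x) U = U. This last map is split: if
    eps e = 1, a splitting is v |-> e (x) v, because v (x) 1 = 1 (x) v in
    U (x) U. Hence, if d x lies in m P0, then x (x) 1 lies in m (P1 (x) U)
    ([tens_one_ideal_mul]). Now there are two cases.
    - If 1 is not in m U, apply the functionals f : P1 -> R: each f(x) 1 lies in
      m U, so f(x) is not invertible modulo m and belongs to m; thus x is in
      m P1.
    - If 1 = \sum_i a_i v_i with a_i in m, lift the multiplications by the v_i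
      to chain endomorphisms V_i of P. The chain map \sum_i a_i V_i lifts the
      identity of U, hence is homotopic to the identity of P by some
      s : P0 -> P1, and x = \sum_i a_i V_i x + s (d x) is in m P1
      ([ideal_mul_of_unit_ideal]).
    Homologically: Tor_1(U, R/m) is a U-module, so it vanishes when m U = U,
    and otherwise R/m is itself a U-module and Tor_1(U, R/m) is Tor_1(U, U)
    tensored with it.

    From residue fields to purity ([local_retraction]): given finitely many
    elements of P1, restrict the functionals of P1 to them. The restrictions
    form a finitely generated module E by the dual basis lemma, and those that
    factor through d form a submodule E'. Injectivity of d at m gives
    E = E' + m E for all m by linear algebra over R/m, so E = E' by Nakayama's
    lemma, and a dual basis of P1 turns this into a linear map r : P0 -> P1
    with r (d x) = x on the given elements. With these partial retractions,
    the flatness of P0 descends to U ([flat_of_local_retraction]). *)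

Set Implicit Arguments.
Unset Strict Implicit.
Unset Printing Implicit Defensive.

Import GRing.Theory.
Local Open Scope ring_scope.

(** * Submodules, maximal ideals and Nakayama's lemma *)

Section Submodules.
Variable R : comPzRingType.
Implicit Types (V W : lmodType R) (I : R^o -> Prop).

(** A Prop-valued variant of [submod_closed]: all the submodules below are given
    by existential statements. Ideals are the submodules of R^o. *)
Definition submodule V (S : V -> Prop) :=
  S 0 /\ forall a x y, S x -> S y -> S (a *: x + y).

Lemma submoduleD V (S : V -> Prop) x y :
  submodule S -> S x -> S y -> S (x + y).
Proof. by case=> _ SP Sx Sy; rewrite -[x]scale1r; apply: SP. Qed.

Lemma submoduleZ V (S : V -> Prop) a x : submodule S -> S x -> S (a *: x).
Proof. by case=> S0 SP Sx; rewrite -[_ *: _]addr0; apply: SP. Qed.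

Lemma submoduleN V (S : V -> Prop) x : submodule S -> S x -> S (- x).
Proof. by move=> SP Sx; rewrite -scaleN1r; apply: submoduleZ. Qed.

Lemma submoduleB V (S : V -> Prop) x y :
  submodule S -> S x -> S y -> S (x - y).
Proof. by move=> SP Sx Sy; apply: submoduleD => //; apply: submoduleN. Qed.

Lemma submodule_sum V (S : V -> Prop) (T : eqType) (s : seq T) (F : T -> V) :
  submodule S -> (forall i, i \in s -> S (F i)) -> S (\sum_(i <- s) F i).
Proof.
move=> SP SF; rewrite big_seq; apply: (@big_ind _ S) => //; first exact: SP.1.
by move=> x y; apply: submoduleD.
Qed.

(** The product I V, for an ideal I. Allowing one generator at a time makes
    structural induction match the proofs by sums. *)
Inductive ideal_mul I V : V -> Prop :=
| IdealMul0 : ideal_mul I 0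
| IdealMulD a x y : I a -> ideal_mul I y -> ideal_mul I (a *: x + y).

Lemma ideal_mulZ I V a (x : V) : I a -> ideal_mul I (a *: x).
Proof.
by move=> Ia; rewrite -[_ *: _]addr0; apply: IdealMulD => //; apply: IdealMul0.
Qed.

Lemma ideal_mul_submodule I V : submodule I -> submodule (@ideal_mul I V).
Proof.
move=> IP; split=> [|a x y]; first exact: IdealMul0.
elim=> [|b z t Ib _ IHz] yI; first by rewrite scaler0 add0r.
rewrite scalerDr -addrA scalerA; apply: IdealMulD; last exact: IHz.
exact: (@submoduleZ R^o I a b).
Qed.

Lemma ideal_mul_linear I V W (f : {linear V -> W}) x :
  ideal_mul I x -> ideal_mul I (f x).
Proof.
elim=> [|a y z Ia _ IHz]; first by rewrite linear0; apply: IdealMul0.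
by rewrite linearP; apply: IdealMulD.
Qed.

Lemma ideal_mul_regular I (a : R^o) : submodule I -> ideal_mul I a -> I a.
Proof.
move=> IP; elim=> [|b x y Ib _ IHy]; first exact: IP.1.
apply: submoduleD => //; have -> : b *: x = (x : R) *: b by apply: mulrC.
exact: submoduleZ.
Qed.

(** The submodule N + I c_1 + ... + I c_n. *)
Fixpoint span_mod I V (N : V -> Prop) (cs : seq V) (v : V) : Prop :=
  if cs is c :: cs' then exists2 a, I a & span_mod I N cs' (v - a *: c)
  else N v.

Lemma span_mod_submodule I V (N : V -> Prop) cs :
  submodule I -> submodule N -> submodule (span_mod I N cs).
Proof.
move=> IP NP; elim: cs => //= c cs [IH0 IHs]; split=> [|a x y [b Ib xs] [b' Ib' ys]].
  by exists 0; [apply: IP.1|rewrite scale0r subr0].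
exists (a * b + b'); first exact: IP.2.
rewrite scalerDl -scalerA opprD addrACA -scalerBr; exact: IHs.
Qed.

Lemma span_mod_base I V (N : V -> Prop) cs v :
  submodule I -> N v -> span_mod I N cs v.
Proof.
move=> IP Nv; elim: cs => //= c cs IH.
by exists 0; [apply: IP.1|rewrite scale0r subr0].
Qed.

Lemma span_modZ I V (N : V -> Prop) cs a c :
  submodule I -> submodule N -> I a -> c \in cs -> span_mod I N cs (a *: c).
Proof.
move=> IP NP Ia; elim: cs => //= c' cs IH; rewrite inE => /orP[/eqP ->|ccs].
  by exists a => //; rewrite subrr; apply: (span_mod_submodule cs IP NP).1.
by exists 0; [apply: IP.1|rewrite scale0r subr0; apply: IH].
Qed.

Definition maximal_ideal I :=
  [/\ submodule I, ~ I 1 & forall a, ~ I a -> exists c, I (1 - c * a)].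

Lemma maximal_ideal_exists (J : R^o -> Prop) :
  submodule J -> ~ J 1 ->
  exists2 m, maximal_ideal m & forall a, J a -> m a.
Proof.
move=> JP J1.
(* the union with J makes the empty chain admissible *)
pose P (A : set R^o) := submodule (A `|` J)%classic /\ ~ (A `|` J)%classic 1.
have [F FP Ftot|A [[AP A1] Amax]] := @Zorn_bigcup R^o P.
  split; last first.
    by case=> // -[A FA A1]; have [_] := FP A FA; apply; left.
  split=> [|a x y]; first by right; apply: JP.1.
  have step (A : set R^o) : F A -> (A `|` J)%classic x -> (A `|` J)%classic y ->
      (\bigcup_(X in F) X `|` J)%classic (a *: x + y).
    move=> FA xA yA; have [[_ AP] _] := FP A FA.
    by case: (AP a x y xA yA) => ?; [left; exists A|right].
  case=> [[A FA Ax]|Jx] [[B FB By]|Jy].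
  - have [AB|BA] := Ftot _ _ FA FB.
      by apply: (step B) => //; left=> //; apply: AB.
    by apply: (step A) => //; left=> //; apply: BA.
  - by apply: (step A) => //; [left|right].
  - by apply: (step B) => //; [right|left].
  - by right; apply: JP.2.
(* if a is not invertible modulo the ideal A u J, then B = (A u J) + R a is a
   larger proper ideal *)
exists (A `|` J)%classic; last by right.
split=> // a Aa.
pose B : set R^o := fun x => exists2 c, (A `|` J)%classic (x - c * a) & True.
have AB x : (A `|` J)%classic x -> B x by move=> ?; exists 0; rewrite ?mul0r ?subr0.
apply: contrapT => nB; apply: (Amax B).
  split=> [x Ax|BA]; first by apply: AB; left.
  apply: Aa; left; apply: BA.
  by exists 1; rewrite ?mul1r ?subrr//; apply: AP.1.
have BJ x : (B `|` J)%classic x <-> B x.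
  by split=> [[//|Jx]|]; [apply: AB; right|left].
split; last by move/BJ => [c ? _]; apply: nB; exists c.
split=> [|b x y /BJ[c xc _] /BJ[c' yc _]]; apply/BJ; first by apply: AB; apply: AP.1.
exists (b * c + c') => //.
have -> : b *: x + y - (b * c + c') * a = b *: (x - c * a) + (y - c' * a) :> R^o.
  by rewrite /= scalerBr mulrDl opprD addrACA -mulrA.
exact: AP.2.
Qed.

Lemma span_mod_weaken I V (N : V -> Prop) cs v :
  span_mod I N cs v -> span_mod (fun=> True) N cs v.
Proof. by elim: cs v => //= c cs IH v [a _ vc]; exists a => //; apply: IH. Qed.

Lemma span_mod_scale I V (N : V -> Prop) cs a v :
  submodule I -> submodule N -> I a ->
  span_mod (fun=> True) N cs v -> span_mod I N cs (a *: v).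
Proof.
move=> IP NP Ia; elim: cs v => [|c cs IH] v /=; first exact: submoduleZ.
move=> [b _ vb]; exists (a * b); last by rewrite -scalerA -scalerBr; apply: IH.
by rewrite mulrC; apply: (@submoduleZ R^o I b a).
Qed.

Lemma span_mod_absorb I V (N : V -> Prop) cs v :
  submodule N -> (forall c, c \in cs -> N c) -> span_mod I N cs v -> N v.
Proof.
move=> NP; elim: cs v => //= c cs IH v csN [a _ va].
rewrite -[v](subrK (a *: c)); apply: submoduleD => //.
  by apply: IH => // x xcs; apply: csN; rewrite inE xcs orbT.
by apply: submoduleZ => //; apply: csN; rewrite mem_head.
Qed.

(** Nakayama's lemma in its global form: a finitely generated module M with
    M = m M for all maximal ideals m is zero, here for M = (N + <cs>) / N. The
    generators are eliminated one by one: if c = n + a c + (other generators)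
    with a in m, then 1 - a belongs to the ideal of the s such that s c lies in
    N + <other generators>, so that no m contains this ideal. *)
Lemma nakayama V (N : V -> Prop) (cs : seq V) :
  submodule N ->
  (forall m, maximal_ideal m -> forall c, c \in cs -> span_mod m N cs c) ->
  forall c, c \in cs -> N c.
Proof.
move=> NP; elim: cs => // c0 cs IH H.
pose T : R^o -> Prop := fun=> True.
have TP : submodule T by [].
have SP := span_mod_submodule cs TP NP.
have c0P : span_mod T N cs c0.
  pose J : R^o -> Prop := fun s => span_mod T N cs (s *: c0).
  have JP : submodule J.
    split=> [|a s t Js Jt]; first by rewrite /J scale0r; apply: SP.1.
    by rewrite /J scalerDl -scalerA; apply: SP.2.
  rewrite -[c0]scale1r; apply: contrapT => nJ.
  have [m mmax Jm] := maximal_ideal_exists JP nJ.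
  have [mP m1 _] := mmax.
  have [a ma ac] := H m mmax c0 (mem_head _ _).
  apply: m1; rewrite -[1](subrK a); apply: submoduleD => //; apply: Jm.
  by rewrite /J scalerBl scale1r; apply: span_mod_weaken ac.
have csN c : c \in cs -> N c.
  apply: IH => m mmax c' c'cs; have [mP _ _] := mmax.
  have [|a ma ac] := H m mmax c'; first by rewrite inE c'cs orbT.
  rewrite -[c'](subrK (a *: c0)); apply: submoduleD => //.
    exact: span_mod_submodule.
  exact: span_mod_scale.
by move=> c; rewrite inE => /orP[/eqP->|/csN//]; apply: span_mod_absorb c0P.
Qed.

End Submodules.

(** * Projective modules and dual bases *)

Section Projective.
Variable R : comPzRingType.
Implicit Types (A B M N P : lmodType R).

Lemma projective_section P : projective P ->
  exists s : {linear P -> freemod R P}, forall x, freelift id (s x) = x.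
Proof.
move=> Pproj.
have [x|s sP] := Pproj _ _ (freelift id : {linear _ -> _}) (idfun : {linear P -> P}).
  by exists (fgen R x); rewrite /= freelift_gen.
by exists s.
Qed.

(** The definition of projectivity lifts maps along surjections only; here g is
    surjective onto the image of f, as for the maps of an exact complex. *)
Lemma projective_lift P A B (f : {linear P -> B}) (g : {linear A -> B}) :
  projective P -> (forall x, exists a, g a = f x) ->
  exists h : {linear P -> A}, forall x, g (h x) = f x.
Proof.
move=> /projective_section[s sP] /choice[c cP].
exists (freelift c \o s : {linear _ -> _}) => x /=.
rewrite -[in RHS](sP x).
apply: (@freemod_ext _ _ _ (g \o freelift c : {linear _ -> _})
  (f \o freelift id : {linear _ -> _})) => k /=.
by rewrite !freelift_gen.
Qed.

Definition coord (K : choiceType) (k : K) (x : freemod R K) : R^o := x@_k.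

Fact coord_linear (K : choiceType) (k : K) : linear (coord k).
Proof. by move=> a x y; rewrite /coord mcoeffD fscaleE. Qed.

HB.instance Definition _ (K : choiceType) (k : K) :=
  GRing.isLinear.Build R (freemod R K) R^o *:%R (coord k) (coord_linear k).

(** The dual basis lemma, with the index list chosen uniformly for finitely many
    elements: the coordinate functionals come from a section of the free cover,
    and the list is the union of the supports. *)
Lemma projective_dual_basis P : projective P ->
  exists h : P -> {linear P -> R^o}, forall ps : seq P, exists bs : seq P,
    {in ps, forall p, p = \sum_(b <- bs) (h b p : R) *: b}.
Proof.
move=> /projective_section[s sP].
exists (fun k => coord k \o s : {linear _ -> _}) => ps.
exists (\big[@fsetU P/fset0]_(p <- ps) msupp (s p))%fset => p pps /=.
rewrite -{1}(sP p); apply: freeliftEw.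
elim: ps pps => // q ps IH; rewrite inE big_cons => /orP[/eqP->|/IH ?].
  exact: fsubsetUl.
exact: fsubset_trans (fsubsetUr _ _).
Qed.

Lemma projective_mem_ideal_mul P (I : R^o -> Prop) y :
  projective P -> submodule I ->
  (forall h : {linear P -> R^o}, I (h y)) -> ideal_mul I y.
Proof.
move=> /projective_dual_basis[h hP] IP Iy.
have [bs /(_ y (mem_head _ _)) ->] := hP [:: y].
by apply: submodule_sum => [|b _]; [apply: ideal_mul_submodule|apply: ideal_mulZ].
Qed.

End Projective.

(** * Tensor products *)

Section Tensor.
Variable R : comPzRingType.
Implicit Types (A B C M N P : lmodType R).

Lemma tensDl M N (x x' : M) (y : N) : tens (x + x') y = tens x y + tens x' y.
Proof. by have := (tens_bilinear M N).1 y 1 x x'; rewrite !scale1r. Qed.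

Lemma tensDr M N (x : M) (y y' : N) : tens x (y + y') = tens x y + tens x y'.
Proof. by have := (tens_bilinear M N).2 x 1 y y'; rewrite !scale1r. Qed.

Lemma tens0l M N (y : N) : tens (0 : M) y = 0.
Proof. by apply: (@addrI _ (tens 0 y)); rewrite -tensDl !addr0. Qed.

Lemma tens0r M N (x : M) : tens x (0 : N) = 0.
Proof. by apply: (@addrI _ (tens x 0)); rewrite -tensDr !addr0. Qed.

Lemma tensZl M N a (x : M) (y : N) : tens (a *: x) y = a *: tens x y.
Proof. by have := (tens_bilinear M N).1 y a x 0; rewrite tens0l !addr0. Qed.

Lemma tensZr M N a (x : M) (y : N) : tens x (a *: y) = a *: tens x y.
Proof. by have := (tens_bilinear M N).2 x a y 0; rewrite tens0r !addr0. Qed.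

Lemma tens_sum M N (t : tensor M N) :
  exists s : seq (M * N), t = \sum_(p <- s) tens p.1 p.2.
Proof.
have [z <-] := qproj_surj t; rewrite (freemodE z) linear_sum.
exists [seq (z@_k *: k.1, k.2) | k <- msupp z].
by rewrite big_map; apply: eq_bigr => -[x y] _; rewrite linearZ /= tensZl.
Qed.

Lemma tensor_ind M N (Q : tensor M N -> Prop) :
  Q 0 -> (forall x y t, Q t -> Q (tens x y + t)) -> forall t, Q t.
Proof.
move=> Q0 QD t; have [s ->] := tens_sum t.
by elim: s => [|[x y] s IH]; rewrite ?big_nil // big_cons; apply: QD.
Qed.

Lemma tensor_map_surj M M' N N' (f : {linear M -> M'}) (g : {linear N -> N'}) :
  surjective f -> surjective g -> surjective (tensor_map f g).
Proof.
move=> fs gs; elim/tensor_ind => [|x y t [t' <-]]; first by exists 0; rewrite linear0.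
have [x' <-] := fs x; have [y' <-] := gs y.
by exists (tens x' y' + t'); rewrite linearD tensor_map_tens.
Qed.

(** An inverse of B (x) N / Im (f (x) N) -> C (x) N is obtained from any
    set-theoretic section c of g: the class of c x (x) n depends only on x and
    n, since the indeterminacy of c x is in Im f. *)
Lemma tensor_right_exact A B C N (f : {linear A -> B}) (g : {linear B -> C}) t :
  exact_at f g -> surjective g ->
  tensor_map g (idfun : {linear N -> N}) t = 0 ->
  exists s, tensor_map f (idfun : {linear N -> N}) s = t.
Proof.
move=> fg gs; have /choice[c cP] := gs.
pose S : {pred tensor B N} :=
  fun t => `[< exists s, tensor_map f (idfun : {linear N -> N}) s = t >].
have SP : submod_closed S.
  split=> [|a x y /asboolP[x' <-] /asboolP[y' <-]]; apply/asboolP.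
    by exists 0; rewrite linear0.
  by exists (a *: x' + y'); rewrite linearP.
have kerS (b b' : B) n : g b = g b' -> tens b n - tens b' n \in S.
  move=> gb; have /fg[a fa] : g (b - b') = 0 by rewrite linearB gb subrr.
  apply/asboolP; exists (tens a n); rewrite tensor_map_tens fa.
  by rewrite tensDl -scaleN1r tensZl scaleN1r.
pose q : {linear tensor B N -> quotmod SP} := qproj SP.
have bilin : is_bilinear (fun x (n : N) => q (tens (c x) n)).
  split=> [n a x x'|x a n n'].
    rewrite -linearP -tensZl -tensDl; apply/qprojP/kerS.
    by rewrite cP linearP /= !cP.
  by rewrite -linearP -tensZr -tensDr.
pose L : {linear tensor C N -> quotmod SP} := tensor_lift bilin.
have liftE s : L (tensor_map g (idfun : {linear N -> N}) s) = q s.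
  elim/tensor_ind: s => [|b n s IH]; first by rewrite !linear0.
  rewrite !linearD tensor_map_tens; congr (_ + _); last exact: IH.
  by rewrite [LHS]tensor_lift_tens; apply/qprojP/kerS; rewrite cP.
move=> gt0; have := liftE t; rewrite gt0 linear0 => q0.
have /qprojP : q t = q 0 by rewrite linear0 -q0.
by rewrite subr0 => /asboolP.
Qed.

Fact tensor_swap_bilinear M N : is_bilinear (fun (x : M) (y : N) => tens y x).
Proof. by split; [apply: (tens_bilinear N M).2|apply: (tens_bilinear N M).1]. Qed.

Definition tensor_swap M N : {linear tensor M N -> tensor N M} :=
  tensor_lift (tensor_swap_bilinear M N).

Arguments tensor_swap {M N}.

Lemma tensor_swap_tens M N (x : M) (y : N) : tensor_swap (tens x y) = tens y x.
Proof. exact: tensor_lift_tens. Qed.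

Lemma tensor_swapK M N : cancel (@tensor_swap M N) (@tensor_swap N M).
Proof.
elim/tensor_ind => [|x y t IH]; first by rewrite !linear0.
by rewrite !linearD /= IH !tensor_swap_tens.
Qed.

Lemma tensor_swap_map M M' N N' (f : {linear M -> M'}) (g : {linear N -> N'}) t :
  tensor_swap (tensor_map f g t) = tensor_map g f (tensor_swap t).
Proof.
elim/tensor_ind: t => [|x y t IH]; first by rewrite !linear0.
by rewrite !linearD IH !(tensor_map_tens, tensor_swap_tens).
Qed.

Lemma tensor_right_exactr A B C N (f : {linear A -> B}) (g : {linear B -> C}) t :
  exact_at f g -> surjective g ->
  tensor_map (idfun : {linear N -> N}) g t = 0 ->
  exists s, tensor_map (idfun : {linear N -> N}) f s = t.
Proof.
move=> fg gs gt0.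
have [|s sP] := @tensor_right_exact _ _ _ N f g (tensor_swap t) fg gs.
  by rewrite -tensor_swap_map gt0 linear0.
by exists (tensor_swap s); rewrite -tensor_swap_map sP tensor_swapK.
Qed.

Fact contract_bilinear M N (h : {linear N -> R^o}) :
  is_bilinear (fun (x : M) (y : N) => (h y : R) *: x).
Proof.
split=> [y a x x'|x a y y'].
  by rewrite scalerDr !scalerA mulrC.
by rewrite linearP scalerDl scalerA.
Qed.

Definition contract M N (h : {linear N -> R^o}) : {linear tensor M N -> M} :=
  tensor_lift (contract_bilinear M h).

Lemma contract_tens M N (h : {linear N -> R^o}) (x : M) y :
  contract M h (tens x y) = (h y : R) *: x.
Proof. exact: tensor_lift_tens. Qed.

(** With a dual basis, t in B (x) P is the sum of the h_b(t) (x) b, where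
    h_b : B (x) P -> B applies the functional h_b to the second factor; if t is
    killed by g (x) P, each h_b(t) is killed by g, hence comes from A. *)
Lemma projective_flat P : projective P -> flat P.
Proof.
move=> /projective_dual_basis[h hP] A B C f g fg t; split; last first.
  case=> s <-; elim/tensor_ind: s => [|a p s IH]; first by rewrite !linear0.
  have gf0 : g (f a) = 0 by apply/fg; exists a.
  by rewrite !linearD IH !tensor_map_tens gf0 tens0l addr0.
move=> gt0; have [s tE] := tens_sum t.
have [bs bsP] := hP [seq p.2 | p <- s].
have {}tE : t = \sum_(b <- bs) tens (contract B (h b) t) b.
  rewrite tE; under [RHS]eq_bigr do rewrite linear_sum.
  elim: s bsP {tE} => [|[x y] s IH] bsP.
    by rewrite big_nil big1 // => b _; rewrite big_nil tens0l.
  rewrite big_cons /= {}IH => [|p ps]; last by apply: bsP; rewrite inE ps orbT.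
  under [RHS]eq_bigr do rewrite big_cons tensDl.
  rewrite big_split /=; congr (_ + _).
  rewrite {1}(bsP y (mem_head _ _)).
  rewrite (big_morph (tens x) (tensDr x) (tens0r _ x)); apply: eq_bigr => b _.
  by rewrite contract_tens tensZl tensZr.
have contractE b : g (contract B (h b) t) = 0.
  have <- : contract C (h b) (tensor_map g (idfun : {linear P -> P}) t) =
            g (contract B (h b) t).
    elim/tensor_ind: (t) => [|x y t' IH]; first by rewrite !linear0.
    by rewrite !linearD IH tensor_map_tens !contract_tens linearZ.
  by rewrite gt0 linear0.
have /choice[a aP] b : exists a, f a = contract B (h b) t by apply/fg.
exists (\sum_(b <- bs) tens (a b) b).
by rewrite linear_sum [RHS]tE; apply: eq_bigr => b _; rewrite tensor_map_tens aP.
Qed.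

End Tensor.

(** * From residue fields to partial retractions *)

Section DualCombination.
Variables (R : comPzRingType) (P M : lmodType R).
Variables (g : M -> {linear P -> R^o}) (bs : seq M).

Definition dual_comb (y : P) : M := \sum_(b <- bs) (g b y : R) *: b.

Fact dual_comb_linear : linear dual_comb.
Proof.
move=> a x y; rewrite /dual_comb scaler_sumr -big_split; apply: eq_bigr => b _.
by rewrite linearP scalerDl scalerA.
Qed.

HB.instance Definition _ :=
  GRing.isLinear.Build R P M *:%R dual_comb dual_comb_linear.

End DualCombination.

Section ResidueFields.
Variables (R : comPzRingType) (M P : lmodType R) (d : {linear M -> P}).
Variable m : R^o -> Prop.
Hypothesis mmax : maximal_ideal m.
(* injectivity of d (x) R/m, for P projective: see [projective_mem_ideal_mul] *)
Hypothesis d_inj : forall x,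
  ideal_mul m x \/ exists h : {linear P -> R^o}, ~ m (h (d x)).

Let mP : submodule m. Proof. by case: mmax. Qed.

Lemma span_mod_residue (f : {linear M -> R^o}) (bs : seq M) v :
  (forall b, b \in bs -> m (f b)) ->
  span_mod (fun=> True) (@ideal_mul R m M) bs v -> m (f v).
Proof.
elim: bs v => [|b bs IH] v fbs /=.
  by move=> /(ideal_mul_linear f)/(ideal_mul_regular mP).
move=> [a _ vspan]; rewrite -[v](subrK (a *: b)) linearD [f (a *: b)]linearZ.
apply: submoduleD => //.
  by apply: IH vspan => c cbs; apply: fbs; rewrite inE cbs orbT.
by apply: submoduleZ => //; apply: fbs; rewrite mem_head.
Qed.

(** Duality over the field R/m: in the image of d (x) R/m, a vector outside the
    span of finitely many others is detected by a functional vanishing on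
    these. In the inductive step, y is projected along b to the kernel of the
    functional h1, which takes the value 1 at b modulo m. *)
Lemma residue_separate (bs : seq M) y :
  span_mod (fun=> True) (@ideal_mul R m M) bs y \/
  exists2 h : {linear P -> R^o},
    (forall b, b \in bs -> m (h (d b))) & ~ m (h (d y)).
Proof.
elim: bs y => [|b bs IH] y.
  by have [|[h hy]] := d_inj y; [left|right; exists h].
have [bspan|[h hbs hb]] := IH b.
  have [yspan|[h hbs hy]] := IH y; [left|right].
    by exists 0 => //; rewrite scale0r subr0.
  exists h => // c; rewrite inE => /orP[/eqP->|/hbs//].
  exact: (@span_mod_residue (h \o d : {linear _ -> _}) _ _ hbs).
have [_ _ /(_ _ hb)[c hc]] := mmax.
pose h1 : {linear P -> R^o} := c \*: h.
have h1bs b' : b' \in bs -> m (h1 (d b')).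
  by move=> /hbs; apply: submoduleZ.
have [yspan|[h' h'bs h'y]] := IH (y - (h1 (d y) : R) *: b); [left|right].
  by exists (h1 (d y)).
exists (h' \+ (- (h' (d b) : R)) \*: h1 : {linear P -> R^o}) => [b'|] /=.
  rewrite inE => /orP[/eqP->|b'bs].
    have -> : h' (d b) + (- (h' (d b) : R)) *: h1 (d b) =
        (h' (d b) : R) *: (1 - c * h (d b)) :> R^o.
      by rewrite scalerBr scaleNr; congr (_ - _); rewrite [RHS]mulr1.
    exact: submoduleZ.
  by apply: submoduleD => //; [apply: h'bs|apply: submoduleZ (h1bs _ b'bs)].
suff <- : h' (d (y - (h1 (d y) : R) *: b)) =
  h' (d y) + (- (h' (d b) : R)) *: h1 (d y) by [].
rewrite !linearB [d (_ *: _)]linearZ [h' (_ *: _)]linearZ scaleNr.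
congr (_ - _); exact: mulrC.
Qed.

(** Over R/m, every functional extends along the injection d (x) R/m. *)
Lemma residue_interpolate (bs : seq M) (f : {linear M -> R^o}) :
  exists g : {linear P -> R^o}, forall b, b \in bs -> m (f b - g (d b)).
Proof.
elim: bs => [|b bs [g IH]]; first by exists \0.
have [bspan|[h hbs hb]] := residue_separate bs b.
  exists g => b'; rewrite inE => /orP[/eqP->|/IH//].
  exact: (@span_mod_residue (f \- (g \o d) : {linear M -> R^o}) _ _ IH bspan).
have [_ _ /(_ _ hb)[c hc]] := mmax.
pose e : R := f b - g (d b).
exists (g \+ (e * c) \*: h : {linear P -> R^o}) => b' /=.
rewrite opprD addrA inE => /orP[/eqP->|b'bs].
  have -> : f b - g (d b) - (e * c) *: h (d b) = e *: (1 - c * h (d b)) :> R^o.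
    by rewrite scalerBr -scalerA; congr (_ - _); rewrite [RHS]mulr1.
  exact: submoduleZ.
apply: submoduleB => //; first exact: IH.
by apply: submoduleZ => //; apply: hbs.
Qed.

End ResidueFields.

(** The elements b of the dual basis serve twice: the interpolation at m is
    performed on them rather than on xs, because an error f := h b - g o d with
    values f(b') in m on the b' is equal to \sum_b' f(b') h_b' on xs, hence
    lies in m E and not merely in the elements of E with values in m. *)
Lemma local_retraction (R : comPzRingType) (M P : lmodType R)
    (d : {linear M -> P}) :
  projective M ->
  (forall m, maximal_ideal m -> forall x,
    ideal_mul m x \/ exists h : {linear P -> R^o}, ~ m (h (d x))) ->
  forall xs : seq M, exists r : {linear P -> M}, {in xs, forall x, r (d x) = x}.
Proof.
move=> /projective_dual_basis[h hP] d_inj xs; have [bs bsP] := hP xs.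
pose ev (f : M -> R^o) : 'rV[R]_(size xs) := \row_i f (nth 0 xs i).
pose N v := exists g : {linear P -> R^o}, v = ev (g \o d).
have NP : submodule N.
  split=> [|a _ _ [g ->] [g' ->]].
    by exists \0; apply/rowP=> i; rewrite !mxE.
  by exists (a \*: g \+ g' : {linear _ -> _}); apply/rowP=> i; rewrite !mxE.
have evN b : b \in bs -> N (ev (h b)).
  move=> bbs; apply: (@nakayama _ _ N [seq ev (h b) | b <- bs]) => //; last first.
    exact: map_f.
  move=> m mmax _ /mapP[{bbs}b bbs ->]; have [mP _ _] := mmax.
  have [g gP] := residue_interpolate mmax (d_inj m mmax) bs (h b).
  have -> : ev (h b) = ev (g \o d) +
      \sum_(b' <- bs) (h b b' - g (d b') : R) *: ev (h b').
    apply/rowP=> i; rewrite !mxE summxE.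
    have := bsP _ (mem_nth 0 (ltn_ord i)); set x := nth 0 xs i => xE.
    rewrite -[LHS](subrK (g (d x))) addrC; congr (_ + _).
    pose f : {linear M -> R^o} := h b \- (g \o d).
    rewrite -[LHS]/(f x) {1}xE linear_sum; apply: eq_bigr => b' _.
    by rewrite linearZ !mxE /= mulrC.
  have SP := span_mod_submodule [seq ev (h b) | b <- bs] mP NP.
  apply: submoduleD => //.
    by apply: span_mod_base => //; exists g.
  apply: submodule_sum => // b' b'bs.
  by apply: span_modZ => //; [apply: gP|apply: map_f].
have /choice[g gP] b : exists g : {linear P -> R^o},
    b \in bs -> ev (h b) = ev (g \o d).
  by have [/evN[g gE]|_] := boolP (b \in bs); [exists g|exists \0].
exists (dual_comb g bs : {linear _ -> _}) => x xxs.
rewrite [RHS](bsP x xxs) /= /dual_comb big_seq [RHS]big_seq.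
apply: eq_bigr => b /gP/rowP.
have xi : (index x xs < size xs)%N by rewrite index_mem.
by move=> /(_ (Ordinal xi)); rewrite !mxE /= nth_index // => ->.
Qed.

(** * Projective resolutions of length one *)

Section Resolution.
Variable R : comPzRingType.

Lemma homology_zero (A B C : lmodType R) (f : {linear A -> B}) (g : {linear B -> C}) :
  zero_module (homology f g) -> forall y, g y = 0 -> exists x, f x = y.
Proof.
move=> H y gy; have yP : y \in linker g by apply/eqP.
have /qprojP : qproj (boundaries_submod f g) (KerMod yP) = qproj _ 0.
  by rewrite [LHS]H linear0.
by rewrite subr0 => /asboolP.
Qed.

Section Short.
Variables (M P1 P0 : lmodType R) (d : {linear P1 -> P0}) (eps : {linear P0 -> M}).
Hypotheses (P1proj : projective P1) (P0proj : projective P0).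
Hypotheses (d_inj : injective d) (d_eps : exact_at d eps) (eps_surj : surjective eps).

(** A lift (w, v) of the identity of M is homotopic to the identity: id - w has
    values in the image of d, and s is a lift of it along d. As d is injective,
    this homotopy relation in degree 0 implies the one in degree 1. *)
Lemma homotopy_lift (w : {linear P0 -> P0}) (v : {linear P1 -> P1}) :
  (forall x, eps (w x) = eps x) -> (forall x, d (v x) = w (d x)) ->
  exists s : {linear P0 -> P1}, forall x, x = v x + s (d x).
Proof.
move=> epsw dv.
have [x|s sP] := projective_lift (f := idfun \- w : {linear P0 -> P0}) (g := d) P0proj.
  by apply/d_eps; rewrite linearB /= epsw subrr.
exists s => x; apply: d_inj.
by rewrite linearD dv sP /= addrC subrK.
Qed.

(** Tor is computed with the standard free resolution F; a cycle of P (x) N is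
    sent to F (x) N and back, which changes it by a boundary only, and P has no
    boundary in degree 1. *)
Lemma tor1_zero_injective (N : lmodType R) : zero_module (Tor 1 M N) ->
  forall t, tensor_map d (idfun : {linear N -> N}) t = 0 -> t = 0.
Proof.
move=> /homology_zero Hz t dt0; pose i := idfun : {linear N -> N}.
move: (free_res M) Hz => F Hz.
have {}Hz y : tensor_map (res_d F 0) i y = 0 ->
    exists x, tensor_map (res_d F 1) i x = y by exact: Hz.
have F_ex0 := @res_exact0 _ _ F; have F_ex1 := @res_exact _ _ F 0.
have [x|a0 a0P] := projective_lift (f := eps) (g := res_eps F) P0proj.
  exact: res_surj.
have [x|a1 a1P] :=
    projective_lift (f := a0 \o d : {linear _ -> _}) (g := res_d F 0) P1proj.
  by apply/F_ex0; rewrite /= a0P; apply/d_eps; exists x.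
have [x|b0 b0P] := projective_lift (f := res_eps F) (g := eps) (@res_proj _ _ F 0).
  exact: eps_surj.
have dd0 x : res_d F 0 (res_d F 1 x) = 0 by apply/F_ex1; exists x.
have [x|b1 b1P] := projective_lift (f := b0 \o res_d F 0 : {linear _ -> _})
    (g := d) (@res_proj _ _ F 1).
  by apply/d_eps; rewrite /= b0P; apply/F_ex0; exists x.
have [x|x|s sP] := @homotopy_lift (b0 \o a0 : {linear _ -> _}) (b1 \o a1 : {linear _ -> _}).
- by rewrite /= b0P a0P.
- by rewrite /= b1P /= a1P.
have [|z zP] := Hz (tensor_map a1 i t).
  transitivity (tensor_map a0 i (tensor_map d i t)); last by rewrite dt0 linear0.
  elim/tensor_ind: (t) => [|x y t' IH]; first by rewrite !linear0.
  by rewrite !linearD IH !tensor_map_tens a1P.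
have tE : t = tensor_map b1 i (tensor_map a1 i t) + tensor_map s i (tensor_map d i t).
  elim/tensor_ind: (t) => [|x y t' IH]; first by rewrite !linear0 addr0.
  rewrite !linearD !tensor_map_tens addrACA -IH; congr (_ + _).
  by rewrite -tensDl; congr (tens _ y); apply: sP.
rewrite tE dt0 linear0 addr0 -zP.
elim/tensor_ind: (z) => [|x y z' IH]; first by rewrite !linear0.
rewrite !linearD IH addr0 !tensor_map_tens.
suff -> : b1 (res_d F 1 x) = 0 by rewrite tens0l.
by apply: d_inj; rewrite b1P /= dd0 !linear0.
Qed.

(** Let t in B (x) M vanish in C (x) M, and lift it to t0 in B (x) P0. Then
    (g (x) P0) t0 = (C (x) d) w for some w, which involves finitely many
    elements of P1; if r retracts d on these, t0 - (B (x) d r) t0 is another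
    lift of t, and it is killed by g (x) P0, so that it comes from A (x) P0 by
    flatness of P0. *)
Lemma flat_of_local_retraction :
  (forall xs : seq P1, exists r : {linear P0 -> P1}, {in xs, forall x, r (d x) = x}) ->
  flat M.
Proof.
move=> retr A B C f g fg t.
split; last first.
  case=> s <-; elim/tensor_ind: s => [|a p s IH]; first by rewrite !linear0.
  have gf0 : g (f a) = 0 by apply/fg; exists a.
  by rewrite !linearD IH !tensor_map_tens gf0 tens0l addr0.
move=> gt0.
have idC (X Y Z W : lmodType R) (k : {linear X -> Y}) (l : {linear Z -> W}) z :
    tensor_map idfun l (tensor_map k idfun z) =
    tensor_map k idfun (tensor_map idfun l z).
  elim/tensor_ind: z => [|x y z' IH]; first by rewrite !linear0.
  by rewrite !linearD IH !tensor_map_tens.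
have [|t0 t0E] := @tensor_map_surj _ B B P0 M idfun eps _ eps_surj t.
  by move=> b; exists b.
have [|w wE] := @tensor_right_exactr _ _ _ _ C d eps (tensor_map g idfun t0) d_eps eps_surj.
  by rewrite idC t0E.
have [s sE] := tens_sum w.
have [r rP] := retr [seq p.2 | p <- s].
pose t1 := t0 - tensor_map idfun d (tensor_map idfun r t0).
have t1E : tensor_map idfun eps t1 = t.
  rewrite linearB t0E -[RHS]subr0; congr (_ - _).
  elim/tensor_ind: (tensor_map _ r t0) => [|x y z' IH]; first by rewrite !linear0.
  have dy0 : eps (d y) = 0 by apply/d_eps; exists y.
  by rewrite !linearD IH !tensor_map_tens dy0 tens0r addr0.
have rdw : tensor_map idfun r (tensor_map idfun d w) = w.
  rewrite sE (linear_sum (tensor_map _ d)) (linear_sum (tensor_map _ r)).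
  apply: eq_big_seq => p ps.
  by rewrite !tensor_map_tens rP ?map_f.
have [|y yE] := (projective_flat P0proj fg t1).1 _.
  by rewrite linearB -!idC -wE rdw subrr.
by exists (tensor_map idfun eps y); rewrite -idC yE.
Qed.

End Short.
End Resolution.

(** * Ring epimorphisms *)

Section Epimorphism.
Variables (R U : comPzRingType) (u : {rmorphism R -> U}).
Variables (P1 P0 : lmodType R) (d : {linear P1 -> P0}) (eps : {linear P0 -> restr u}).
Hypotheses (P1proj : projective P1) (P0proj : projective P0).
Hypotheses (d_inj : injective d) (d_eps : exact_at d eps) (eps_surj : surjective eps).
Hypothesis epi : ring_epi u.
Hypothesis tens_d_inj :
  forall t, tensor_map d (idfun : {linear restr u -> restr u}) t = 0 -> t = 0.

Let one : restr u := (1 : U).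

Lemma ring_epi_tens (v : restr u) : tens v one = tens one v.
Proof.
by apply: (bij_inj epi); rewrite !mul_map_tens /restr_mul mulr1 mul1r.
Qed.

(** The map p |-> p (x) 1 - e (x) eps p, where eps e = 1, takes values in the
    image of d (x) U, because v (x) 1 = 1 (x) v. Writing d x as \sum_i a_i p_i
    with a_i in I, this yields preimages y_i with
    (d (x) U) (x (x) 1) = (d (x) U) (\sum_i a_i y_i), as eps (d x) = 0. *)
Lemma tens_one_ideal_mul (I : R^o -> Prop) x : submodule I ->
  ideal_mul I (d x) -> ideal_mul I (tens x one).
Proof.
move=> IP Idx; have [e eE] := eps_surj one.
pose i := idfun : {linear restr u -> restr u}.
have split_p p : exists y, tens p one = tens e (eps p) + tensor_map d i y.
  have [|y yE] := @tensor_right_exact _ _ _ _ (restr u) d eps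
    (tens p one - tens e (eps p)) d_eps eps_surj.
    by rewrite linearB !tensor_map_tens eE /= ring_epi_tens subrr.
  by exists y; rewrite yE addrC subrK.
have [y Iy yE] : exists2 y, ideal_mul I y &
    tens (d x) one = tens e (eps (d x)) + tensor_map d i y.
  elim: Idx => [|a p q Ia _ [y Iy yE]].
    by exists 0; [apply: IdealMul0|rewrite tens0l !linear0 tens0r addr0].
  have [z zE] := split_p p.
  exists (a *: z + y); first exact: IdealMulD.
  by rewrite tensDl tensZl zE yE !linearP tensDr tensZr scalerDr addrACA.
suff -> : tens x one = y by [].
apply/eqP; rewrite -subr_eq0; apply/eqP/tens_d_inj.
have dx0 : eps (d x) = 0 by apply/d_eps; exists x.
by rewrite linearB tensor_map_tens yE dx0 tens0r add0r subrr.
Qed.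

Fact restr_scale_linear (v : restr u) : linear (restr_mul v).
Proof. exact: (restr_mul_bilinear u).2. Qed.

HB.instance Definition _ (v : restr u) :=
  GRing.isLinear.Build R (restr u) (restr u) *:%R (restr_mul v)
    (restr_scale_linear v).

(** For v = \sum_i a_i v_i, the lift is the sum of the a_i V_i, where V_i is
    an arbitrary lift of the multiplication by v_i. *)
Lemma lift_mul (I : R^o -> Prop) (v : restr u) : submodule I -> ideal_mul I v ->
  exists (f0 : {linear P0 -> P0}) (f1 : {linear P1 -> P1}),
    [/\ forall x, eps (f0 x) = restr_mul v (eps x),
        forall x, d (f1 x) = f0 (d x) &
        forall x, ideal_mul I (f1 x)].
Proof.
move=> IP; elim=> [|a w v' Ia _ [f0 [f1 [f0E f1E f1I]]]].
  exists \0, \0; split=> x /=; first by rewrite linear0 /restr_mul mul0r.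
    by rewrite linear0.
  exact: IdealMul0.
have [x|g0 g0E] := projective_lift (f := restr_mul w \o eps : {linear P0 -> restr u})
  (g := eps) P0proj; first exact: eps_surj.
have [x|g1 g1E] := projective_lift (f := g0 \o d : {linear P1 -> P0}) (g := d) P1proj.
  apply/d_eps; rewrite /= g0E /=.
  have -> : eps (d x) = 0 by apply/d_eps; exists x.
  by rewrite linear0.
exists (a \*: g0 \+ f0 : {linear _ -> _}), (a \*: g1 \+ f1 : {linear _ -> _}).
split=> x /=.
- by rewrite linearP g0E f0E (restr_mul_bilinear u).1.
- by rewrite linearP g1E f1E.
- exact: IdealMulD.
Qed.

(** The case I U = U: the chain map provided by [lift_mul] for v = 1 has values
    in I P1 in degree 1 and is homotopic to the identity. *)
Lemma ideal_mul_of_unit_ideal (I : R^o -> Prop) x : submodule I ->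
  ideal_mul I one -> ideal_mul I (d x) -> ideal_mul I x.
Proof.
move=> IP I1 Idx; have [f0 [f1 [f0E f1E f1I]]] := lift_mul IP I1.
have [y|//|s sP] := homotopy_lift P0proj d_inj d_eps (w := f0) (v := f1).
  by rewrite f0E /restr_mul mul1r.
rewrite [x]sP; apply: submoduleD; first exact: ideal_mul_submodule.
  exact: f1I.
exact: ideal_mul_linear.
Qed.

(** If x were outside m P1, some functional f of P1 would have f(x) invertible
    modulo m. Applying f to x (x) 1 in m (P1 (x) U) then gives 1 in m U, which
    is the case where x is in m P1 after all. *)
Lemma residue_injective (m : R^o -> Prop) x : maximal_ideal m ->
  ideal_mul m x \/ exists h : {linear P0 -> R^o}, ~ m (h (d x)).
Proof.
move=> mmax; have [mP m1 munit] := mmax.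
have [|nh] := pselect (exists h : {linear P0 -> R^o}, ~ m (h (d x))); [by right|left].
have Idx : ideal_mul m (d x).
  apply: projective_mem_ideal_mul => // h.
  by apply: contrapT => hm; apply: nh; exists h.
apply: projective_mem_ideal_mul => // f; apply: contrapT => fx.
have I1x := tens_one_ideal_mul mP Idx.
have I1 : ideal_mul m one.
  have := ideal_mul_linear (@tensor_swap _ _ _) I1x.
  move=> /(ideal_mul_linear (contract (restr u) f)).
  rewrite tensor_swap_tens contract_tens => Ifx.
  have [c mc] := munit _ fx.
  have MP := @ideal_mul_submodule R m (restr u) mP.
  rewrite -[one]scale1r -[1](subrK (c * f x)) scalerDl -scalerA.
  by apply: submoduleD => //; [apply: ideal_mulZ|apply: submoduleZ].
apply: fx; apply: (ideal_mul_regular mP).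
exact: ideal_mul_linear (ideal_mul_of_unit_ideal mP I1 Idx).
Qed.

End Epimorphism.

Theorem theorem5p2 (R U : comPzRingType) (u : {rmorphism R -> U}) :
  ring_epi u ->
  zero_module (Tor 1 (restr u) (restr u)) ->
  proj_dim_le 1 (restr u) ->
  flat (restr u).
Proof.
move=> epi tor0 [P Pz].
have d_inj : injective (res_d P 0).
  move=> x y dxy; apply/eqP; rewrite -subr_eq0; apply/eqP.
  have /(@res_exact _ _ P 0)[z <-] : res_d P 0 (x - y) = 0.
    by rewrite linearB dxy subrr.
  by rewrite (Pz 2 isT z) linear0.
have dtens_inj := tor1_zero_injective (@res_proj _ _ P 1) (@res_proj _ _ P 0) d_inj
  (@res_exact0 _ _ P) (@res_surj _ _ P) tor0.
apply: (flat_of_local_retraction (@res_proj _ _ P 0) (@res_exact0 _ _ P) (@res_surj _ _ P)).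
apply: local_retraction (@res_proj _ _ P 1) _ => m mmax x.
exact: (residue_injective (@res_proj _ _ P 1) (@res_proj _ _ P 0) d_inj
  (@res_exact0 _ _ P) (@res_surj _ _ P) epi dtens_inj).
Qed.
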